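(* Let $(\rho^n,\boldsymbol u^n)\in L_{\mathcal M}(\Omega)\times \boldsymbol H_{\mathcal E,0}(\Omega)$ be such that $\rho^n>0$ on $\Omega$. Then there exists a time-step $\delta t^n_{\mathcal T,\Omega}>0$, depending only upon $\rho^n$, the space discretisation $\mathcal T=(\mathcal M,\mathcal E)$ and the domain $\Omega$, such that for any $0<\delta t\le \delta t^n_{\mathcal T,\Omega}$ the semi-implicit scheme (S1)--(S2) recalled in the context admits a solution $(\rho^{n+1},\boldsymbol u^{n+1})\in L_{\mathcal M}(\Omega)\times \boldsymbol H_{\mathcal E,0}(\Omega)$ such that $\rho^{n+1}>0$.
   Context: Data. $d\in\{1,2,3\}$, $\gamma>1$, $\varepsilon\in(0,1]$; $\Omega\subset\mathbb R^d$ is a bounded open connected set whose closure is a finite union of closed axis-parallel intervals/rectangles/parallelepipeds. $\wp(\rho)=\rho^\gamma$ and $h_\gamma(\rho)=\rho^\gamma/(\gamma-1)$ for $\rho>0$. $\phi$ is a given smooth potential, and the hydrostatic density is $\tilde\rho(x)=\big(\frac{\gamma-1}{\gamma}(C(m_0)-\phi(x))\big)^{1/(\gamma-1)}$ (so $h_\gamma'(\tilde\rho)+\phi=C(m_0)$), where the constant $C(m_0)$ is determined by the total mass $m_0$; it is assumed bounded below by a positive constant on $\Omega$. Mesh. A MAC grid $\mathcal T=(\mathcal M,\mathcal E)$ consists of a partition $\mathcal M$ of $\bar\Omega$ into closed axis-parallel cells (conforming, possibly non-uniform) and the set $\mathcal E=\bigcup_{i=1}^d\mathcal E^{(i)}$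 of their faces, $\mathcal E^{(i)}=\mathcal E^{(i)}_{\rm int}\cup\mathcal E^{(i)}_{\rm ext}$ being the (internal and external) faces orthogonal to the $i$-th canonical vector $e^{(i)}$. $\mathcal E(K)$ is the set of faces of $K$; $\sigma=K|L$ is the internal face common to $K,L$; $\boldsymbol\nu_{\sigma,K}$ is the unit normal to $\sigma$ outward to $K$. For $\sigma=K|L$ the dual cell is $D_\sigma=D_{\sigma,K}\cup D_{\sigma,L}$, with $D_{\sigma,K}$ the half of $K$ adjacent to $\sigma$ (for external $\sigma\in\mathcal E(K)$, $D_\sigma=D_{\sigma,K}$); $\tilde{\mathcal E}(D_\sigma)$ is the set of faces of $D_\sigma$, and $\epsilon=D_\sigma|D_{\sigma'}$ denotes a common dual face. $L_{\mathcal M}(\Omega)$: functions constant on each $K\in\mathcal M$. $\boldsymbol H_{\mathcal E,0}(\Omega)$: vector fields $\boldsymbol u$ whose $i$-th component is constant ($=u_\sigma$) on each $D_\sigma$, $\sigma\in\mathcal E^{(i)}$, and zero for $\sigma\in\mathcal E^{(i)}_{\rm ext}$. For $q\in L_{\mathcal M}(\Omega)$, $\sigma=K|L$: $|D_\sigma|q_{D_\sigma}=|D_{\sigma,K}|q_K+|D_{\sigma,L}|q_L$. Interface values and discrete gradient. For a positive $\rho\in L_{\mathcal M}(\Omega)$ and $\sigma=K|L$, $\rho_\sigma$ is the unique number between $\rho_K$ and $\rho_L$ with $\rho_K^\gamma-\rho_L^\gamma=\rho_\sigma(h_\gamma'(\rho_K)-h_\gamma'(\rho_L))$ if $\rho_K\ne\rho_L$,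 and $\rho_\sigma=\rho_K$ if $\rho_K=\rho_L$. For $\sigma=K|L\in\mathcal E^{(i)}_{\rm int}$, $(\partial^{(i)}_{\mathcal E}q)_\sigma=\frac{|\sigma|}{|D_\sigma|}(q_L-q_K)\,e^{(i)}\cdot\boldsymbol\nu_{\sigma,K}$. Discrete hydrostatic data: $\tilde\rho_K=\frac1{|K|}\int_K\tilde\rho(x)\,dx$, $\phi_K=C(m_0)-h_\gamma'(\tilde\rho_K)$. Fluxes. With $p^{n+1}_K=(\rho^{n+1}_K)^\gamma$ and a stabilisation parameter $\eta>0$ (which may be chosen depending on $\rho^n$ and on the interface), $\delta u^{n+1}_\sigma=\frac{\eta\,\delta t}{\varepsilon^2}\big[(\partial^{(i)}_{\mathcal E}p^{n+1})_\sigma+\rho^{n+1}_\sigma(\partial^{(i)}_{\mathcal E}\phi)_\sigma\big]$ for $\sigma\in\mathcal E^{(i)}_{\rm int}$, zero on external faces. $F_{\sigma,K}(\rho^{n+1},\boldsymbol u^n)=|\sigma|\rho^{n+1}_\sigma(u^n_\sigma-\delta u^{n+1}_\sigma)\,e^{(i)}\cdot\boldsymbol\nu_{\sigma,K}$ for $\sigma\in\mathcal E^{(i)}_{\rm int}$, zero on external faces. Dual fluxes $F_{\epsilon,\sigma}$ ($\sigma=K|L\in\mathcal E^{(i)}_{\rm int}$, $\epsilon\in\tilde{\mathcal E}(D_\sigma)$): zero if $\epsilon\subset\partial\Omega$; if $\epsilon\perp e^{(i)}$ lies in $K$, $F_{\epsilon,\sigma}=\frac12(F_{\sigma',K}-F_{\sigma,K})$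 with $\sigma'$ the face of $K$ opposite to $\sigma$; otherwise $\epsilon$ consists of halves of faces $\tau\in\mathcal E(K)$, $\tau'\in\mathcal E(L)$ and $F_{\epsilon,\sigma}=\frac12(F_{\tau,K}+F_{\tau',L})$. For $\epsilon=D_\sigma|D_{\sigma'}$, $u^n_{\epsilon,\rm up}=u^n_\sigma$ if $F_{\epsilon,\sigma}\ge0$ and $u^n_{\sigma'}$ otherwise. Scheme. Given $(\rho^n,\boldsymbol u^n)$, find $(\rho^{n+1},\boldsymbol u^{n+1})$ with (S1) $\frac1{\delta t}(\rho^{n+1}_K-\rho^n_K)+\frac1{|K|}\sum_{\sigma\in\mathcal E(K)}F_{\sigma,K}(\rho^{n+1},\boldsymbol u^n)=0$ for all $K\in\mathcal M$; (S2) $\frac1{\delta t}(\rho^{n+1}_{D_\sigma}u^{n+1}_\sigma-\rho^n_{D_\sigma}u^n_\sigma)+\frac1{|D_\sigma|}\sum_{\epsilon\in\tilde{\mathcal E}(D_\sigma)}F_{\epsilon,\sigma}(\rho^{n+1},\boldsymbol u^n)u^n_{\epsilon,\rm up}+\frac1{\varepsilon^2}(\partial^{(i)}_{\mathcal E}p^{n+1})_\sigma=-\frac1{\varepsilon^2}\rho^{n+1}_\sigma(\partial^{(i)}_{\mathcal E}\phi)_\sigma$ for all $\sigma\in\mathcal E^{(i)}_{\rm int}$, $1\le i\le d$.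
   Formalization: The time-step depends on the maximum of |u^n| as well as on ρ^n, T and Ω, and may depend on the fixed parameters γ, ε, φ, C(m_0), η; as literally stated (uniform in u^n) the claim fails, e.g. for two cells in dimension 1 with a large velocity. *)

(* Defs.v *)
From HB Require Import structures.
From mathcomp Require Import all_boot all_order all_algebra finmap.
From mathcomp Require Import all_classical all_reals all_analysis.
From mathcomp Require Import ring lra.

Set Implicit Arguments.
Unset Strict Implicit.
Unset Printing Implicit Defensive.

Import Order.TTheory GRing.Theory Num.Theory.
Import numFieldNormedType.Exports.

Local Open Scope classical_set_scope.
Local Open Scope ring_scope.

Section Space.
Context {R : realType}.

(* Iterated Lebesgue integrals; by Fubini-Tonelli [integral_on A f] is the
   d-dimensional Lebesgue integral of f over A for a Borel function f that is
   bounded on the bounded Borel set A. *)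
Fixpoint iterated_integral (d : nat) : ('rV[R]_d -> R) -> R :=
  match d with
  | 0 => fun f => f 0
  | n.+1 => fun f => \int[lebesgue_measure]_(t in [set: R])
      iterated_integral (fun y : 'rV[R]_n => f (row_mx (t%:M : 'rV[R]_1) y))
  end.

Definition integral_on d (A : set 'rV[R]_d) (f : 'rV[R]_d -> R) : R :=
  iterated_integral (fun x => f x * \1_A x).

Definition boundary d (A : set 'rV[R]_d) : set 'rV[R]_d := closure A `\` A°.

Fixpoint class_C d (n : nat) (U : set 'rV[R]_d) (f : 'rV[R]_d -> R) : Prop :=
  (forall x, U x -> {for x, continuous f}) /\
  match n with
  | 0 => True
  | m.+1 => forall i : 'I_d,
      (forall x, U x -> derivable f x (delta_mx 0 i)) /\
      class_C m U (fun x => 'D_(delta_mx 0 i) f x)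
  end.

(* Smooth up to the boundary of A: smooth on an open neighbourhood of the
   closure. *)
Definition smooth_on_closure d (A : set 'rV[R]_d) (f : 'rV[R]_d -> R) : Prop :=
  exists U, [/\ open U, closure A `<=` U & forall n, class_C n U f].

(* The pair (lo, hi) stands for the closed box with sides [lo_j, hi_j]; faces
   are boxes that are degenerate in one direction. *)
Definition box (d : nat) := ('rV[R]_d * 'rV[R]_d)%type.

Section Box.
Variable d : nat.
Implicit Types (b : box d) (i j : 'I_d) (s : bool).

Definition lo b j : R := b.1 0 j.
Definition hi b j : R := b.2 0 j.

Definition bset b : set 'rV[R]_d := [set x | forall j, lo b j <= x 0 j <= hi b j].

Definition nondegenerate b : Prop := forall j, lo b j < hi b j.

Definition vol b : R := \prod_(j < d) (hi b j - lo b j).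

(* The (d-1)-dimensional measure of a face orthogonal to e_i (1 if d = 1). *)
Definition area i b : R := \prod_(j < d | j != i) (hi b j - lo b j).

(* The face of b orthogonal to e_i, on its upper (s = true) or lower
   (s = false) side; e_i . nu = nu s for the unit normal nu outward to b. *)
Definition side b i s : box d :=
  if s then (\row_j (if j == i then hi b j else lo b j), b.2)
  else (b.1, \row_j (if j == i then lo b j else hi b j)).

Definition nu s : R := if s then 1 else -1.

Definition half b i s : box d :=
  let mid := (lo b i + hi b i) / 2 in
  if s then (\row_j (if j == i then mid else lo b j), b.2)
  else (b.1, \row_j (if j == i then mid else hi b j)).

(* c is a face of b, of any dimension from 0 (a vertex) to d (b itself). *)
Definition subface c b : Prop :=
  forall j, [\/ lo c j = lo b j /\ hi c j = hi b j,
                lo c j = lo b j /\ hi c j = lo b j |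
                lo c j = hi b j /\ hi c j = hi b j].
End Box.

Definition domain d (Omega : set 'rV[R]_d) : Prop :=
  [/\ bounded_set Omega, open Omega, connected Omega &
      exists B : {fset box d}, (forall b, b \in B -> nondegenerate b) /\
        closure Omega = \bigcup_(b in [set` B]) bset b].

Record mac_grid d (Omega : set 'rV[R]_d) := MacGrid {
  cells : {fset box d};
  cells_nondegenerate : forall K, K \in cells -> nondegenerate K;
  cells_cover : \bigcup_(K in [set` cells]) bset K = closure Omega;
  cells_disjoint : forall K L, K \in cells -> L \in cells -> K != L ->
    (bset K)° `&` (bset L)° = set0;
  cells_conforming : forall K L, K \in cells -> L \in cells ->
    bset K `&` bset L = set0 \/
    exists c, [/\ subface c K, subface c L & bset K `&` bset L = bset c]
}.

End Space.

Arguments box R d : clear implicits.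

Section EquationOfState.
Context {R : realType}.
Variable gamma : R.

Definition hgamma (r : R) : R := r `^ gamma / (gamma - 1).

Definition dhgamma : R -> R := derive1 hgamma.

(* powR is 1 on negative numbers, so positivity of C - phi has to be required
   separately in [hydrostatic]. *)
Definition rhotilde d (C : R) (phi : 'rV[R]_d -> R) (x : 'rV[R]_d) : R :=
  ((gamma - 1) / gamma * (C - phi x)) `^ (1 / (gamma - 1)).

Definition hydrostatic d (Omega : set 'rV[R]_d) (phi : 'rV[R]_d -> R)
    (m0 C : R) : Prop :=
  [/\ forall x, Omega x -> 0 < C - phi x,
      exists2 c, 0 < c & forall x, Omega x -> c <= rhotilde C phi x &
      integral_on Omega (rhotilde C phi) = m0].

(* For a != b the equation in [interface_valueP] is linear in rho_sigma. *)
Definition interface_value (a b : R) : R :=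
  if a == b then a else (a `^ gamma - b `^ gamma) / (dhgamma a - dhgamma b).

Lemma dhgammaE (r : R) : 0 < r ->
  dhgamma r = gamma / (gamma - 1) * r `^ (gamma - 1).
Proof.
move=> r0; rewrite /dhgamma derive1E.
have -> : hgamma = (gamma - 1)^-1 *: (fun x : R => x `^ gamma).
  by apply/funext => x; rewrite /hgamma mulrC.
have h := is_derive1_powR gamma r0.
rewrite deriveZ; last by [].
by rewrite derive_val /GRing.scale /= mulrA [_^-1 * _]mulrC.
Qed.

Lemma interface_valueP (a b : R) : 1 < gamma -> 0 < a -> 0 < b ->
  Num.min a b <= interface_value a b <= Num.max a b /\
  a `^ gamma - b `^ gamma = interface_value a b * (dhgamma a - dhgamma b).
Proof.
move=> g1 a0 b0; have g0 : 0 < gamma by lra.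
have h0 : 0 < gamma - 1 by lra.
rewrite /interface_value; case: eqVneq => [->|ab].
  by rewrite minxx maxxx lexx !subrr mulr0.
have young x y : 0 < x -> 0 < y ->
    x * (dhgamma y - dhgamma x) <= y `^ gamma - x `^ gamma.
  move=> x0 y0; rewrite !dhgammaE// -mulrBr.
  have /= := @conjugate_powR R x (y `^ (gamma - 1)) gamma (gamma / (gamma - 1))
    (ltW x0) (powR_ge0 _ _) g0 (divr_gt0 g0 h0).
  have -> : gamma^-1 + (gamma / (gamma - 1))^-1 = 1.
    by field; rewrite !gt_eqF.
  rewrite -powRrM [(gamma - 1) * _]mulrC divfK ?gt_eqF// => /(_ erefl) hy.
  have xE : x `^ gamma = x * x `^ (gamma - 1).
    by rewrite mulr_powRB1 // ltW.
  have -> : x * (gamma / (gamma - 1) * (y `^ (gamma - 1) - x `^ (gamma - 1))) =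
      gamma / (gamma - 1) * (x * y `^ (gamma - 1) - x `^ gamma).
    by rewrite xE; ring.
  rewrite mulrAC ler_pdivrMr//.
  have : gamma * (x * y `^ (gamma - 1)) <=
      gamma * (x `^ gamma / gamma + y `^ gamma / (gamma / (gamma - 1))).
    by rewrite ler_pM2l.
  have -> : gamma * (x `^ gamma / gamma + y `^ gamma / (gamma / (gamma - 1))) =
      x `^ gamma + (gamma - 1) * y `^ gamma.
    by field; rewrite !gt_eqF.
  by move=> hh; lra.
have mono x y : 0 < x -> x < y -> dhgamma x < dhgamma y.
  move=> x0 xy; have y0 := lt_trans x0 xy.
  by rewrite !dhgammaE// ltr_pM2l ?divr_gt0// gt0_ltr_powR // nnegrE ltW.
have hab := young _ _ a0 b0; have hba := young _ _ b0 a0.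
have [lt_ab|lt_ab|eab] := ltgtP a b; last by rewrite eab eqxx in ab.
- have D : dhgamma a - dhgamma b < 0 by rewrite subr_lt0 mono.
  split; last by rewrite divfK// lt_eqF.
  by rewrite ler_ndivlMr// ler_ndivrMr//; apply/andP; split; lra.
- have D : 0 < dhgamma a - dhgamma b by rewrite subr_gt0 mono.
  split; last by rewrite divfK// gt_eqF.
  by rewrite ler_pdivlMr// ler_pdivrMr//; apply/andP; split; lra.
Qed.

End EquationOfState.

Section Mesh.
Context {R : realType} {d : nat} {Omega : set 'rV[R]_d}.
Variable T : mac_grid Omega.
Implicit Types (K L : cells T) (i j : 'I_d) (s : bool).

Definition faces : {fset box R d} :=
  [fset side (val p.1.1) p.1.2 p.2 | p in {: cells T * 'I_d * bool}]%fset.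

Lemma side_in_faces K i s : side (val K) i s \in faces.
Proof. by apply/imfsetP; exists (K, i, s). Qed.

(* As (i, s) varies, [face K i s] runs through E(K). *)
Definition face K i s : faces := [` side_in_faces K i s]%fset.

Definition external (sigma : faces) : bool :=
  `[< bset (val sigma) `<=` boundary Omega >].

Definition across K i s : option (cells T) :=
  [pick L | side (val L) i (~~ s) == side (val K) i s].

(* [neighbor K i s = Some L] iff sigma = face K i s is the internal face K|L. *)
Definition neighbor K i s : option (cells T) :=
  if external (face K i s) then None else across K i s.

(* Functions of L_M(Omega) and fields of H_{E,0}(Omega) are identified with
   their values on the cells and on the (dual cells of the) faces: the values
   of u on the faces orthogonal to e_i are those of its i-th component. *)
Definition H_E0 (u : faces -> R) : Prop :=
  forall sigma, external sigma -> u sigma = 0.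

(* In the following, sigma = K|L = face K i s. *)
Definition dual_vol K L i s : R :=
  vol (half (val K) i s) + vol (half (val L) i (~~ s)).

Definition dual_mean (q : cells T -> R) K L i s : R :=
  (vol (half (val K) i s) * q K + vol (half (val L) i (~~ s)) * q L)
    / dual_vol K L i s.

Definition grad (q : cells T -> R) K L i s : R :=
  area i (side (val K) i s) / dual_vol K L i s * (q L - q K) * nu s.

(* D_sigma, for sigma = face K i true = face L i false. *)
Definition dual_cell K L i : box R d :=
  ((half (val K) i true).1, (half (val L) i false).2).

(* The value u_{sigma'} beyond the face epsilon = side (dual_cell K L i) j s.
   For j != i, sigma' is the face orthogonal to e_i between the cells reached
   from K and from L through epsilon; if only one of these cells exists (a
   reentrant corner of Omega), sigma' is its face on that side. *)
Definition value_beyond (u : faces -> R) K L i j s : R :=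
  if j == i then u (if s then face L i true else face K i false)
  else if across K j s is Some K' then u (face K' i true)
  else if across L j s is Some L' then u (face L' i false)
  else 0.

(* The largest velocity |u_sigma|. An admissible time step cannot be uniform
   in u^n: for two unit cells K, L in dimension 1, (S1) in K reads
   rho_K - rho_K^n + dt rho_sigma (u^n_sigma - du_sigma) = 0, where
   rho_K + rho_L is prescribed by the data, du_sigma is bounded and rho_sigma
   is bounded away from 0 over the positive densities with this sum; hence for
   each dt > 0 there is no positive solution once u^n_sigma is large. *)
Definition max_velocity (u : faces -> R) : R :=
  \big[Num.max/0]_(sigma : faces) `|u sigma|.

Section Scheme.
Variables (gamma eps : R) (C : R) (phi : 'rV[R]_d -> R).
Variables (eta : faces -> R) (dt : R).
Implicit Types (rho rhon : cells T -> R) (u un : faces -> R).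

Definition rhotilde_cell K : R :=
  integral_on (bset (val K)) (rhotilde gamma C phi) / vol (val K).

Definition phi_cell K : R := C - dhgamma gamma (rhotilde_cell K).

Definition pressure rho K : R := rho K `^ gamma.

Definition rho_face rho K L : R := interface_value gamma (rho K) (rho L).

Definition delta_u rho K L i s : R :=
  eta (face K i s) * dt / eps ^+ 2 *
    (grad (pressure rho) K L i s + rho_face rho K L * grad phi_cell K L i s).

Definition flux rho un K i s : R :=
  if neighbor K i s is Some L then
    area i (side (val K) i s) * rho_face rho K L
      * (un (face K i s) - delta_u rho K L i s) * nu s
  else 0.

(* F_{epsilon,sigma} for sigma = K|L = face K i true and
   epsilon = side (dual_cell K L i) j s. *)
Definition dual_flux rho un K L i j s : R :=
  if `[< bset (side (dual_cell K L i) j s) `<=` boundary Omega >] then 0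
  else if j == i then
    if s then (flux rho un L i true - flux rho un L i false) / 2
    else (flux rho un K i false - flux rho un K i true) / 2
  else (flux rho un K j s + flux rho un L j s) / 2.

Definition upwind rho un K L i j s : R :=
  if 0 <= dual_flux rho un K L i j s then un (face K i true)
  else value_beyond un K L i j s.

Definition S1 rhon un rho : Prop :=
  forall K,
    (rho K - rhon K) / dt
      + (\sum_(i < d) \sum_(s : bool) flux rho un K i s) / vol (val K) = 0.

(* Each internal face is written sigma = K|L with K on its lower side. *)
Definition S2 rhon un rho u : Prop :=
  forall i K L, neighbor K i true = Some L ->
    (dual_mean rho K L i true * u (face K i true)
       - dual_mean rhon K L i true * un (face K i true)) / dt
    + (\sum_(j < d) \sum_(s : bool)
         dual_flux rho un K L i j s * upwind rho un K L i j s)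
        / dual_vol K L i true
    + (eps ^+ 2)^-1 * grad (pressure rho) K L i true
    = - ((eps ^+ 2)^-1 * (rho_face rho K L * grad phi_cell K L i true)).

End Scheme.
End Mesh.

(* Main.v *)
Require Import Defs.
From HB Require Import structures.
From mathcomp Require Import all_boot all_order all_algebra finmap.
From mathcomp Require Import all_classical all_reals all_analysis.
From mathcomp Require Import ring lra.

(** The two equations decouple: the mass balance (S1) involves only the new
    density, and once a positive density is known the momentum balance (S2) is
    an explicit formula for the new velocity on each internal face.

    The mass balance has the form rho = rhon - dt * G(rho), where G is the
    discrete divergence of the mass flux.  On a closed ball of densities around
    rhon that stays away from 0, G is bounded and Lipschitz, with constants
    that are uniform over all velocities below a given bound and all time steps
    dt <= 1 (dt occurs inside G through the velocity correction).  Hence for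
    small dt the right-hand side maps this ball into itself and contracts
    distances, and Banach's fixed point theorem gives a positive solution
    ([implicit_euler_solvable], [mass_solvable]).

    The flux is a polynomial expression in the velocities, the time step, the
    pressures rho_K^gamma and the interface densities rho_sigma, so everything
    reduces to the Lipschitz continuity of rho_sigma as a function of
    (rho_K, rho_L) ([interface_value_lipschitz]).  The defining quotient is
    singular on the diagonal; this is bypassed by reading rho_sigma as a mean
    value: it lies between its arguments, and the mean over [x, z] is the
    average of the means over [x, y] and [y, z] weighted by the increments of
    h'_gamma.  As h'_gamma is bi-Lipschitz, moving an endpoint from y to z
    changes the mean by at most a multiple of |z - y|
    ([weighted_mean_lipschitz]).

    That the formula for the velocity is consistent needs one fact on the grid:
    a face is the upper face of at most one cell, because two such cells would
    have overlapping interiors ([upper_face_inj]). *)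

Set Implicit Arguments.
Unset Strict Implicit.
Unset Printing Implicit Defensive.

Import Order.TTheory GRing.Theory Num.Theory.
Import numFieldNormedType.Exports.

Local Open Scope classical_set_scope.
Local Open Scope ring_scope.

(** * The interface density *)

Section InterfaceValue.
Context {R : realType}.
Implicit Types (a b m M x y z : R).

(** By the mean value theorem the slope is a * t ^ (a - 1) for some t between m
    and M.  Writing t ^ (a - 1) as t ^ a / t bounds it on both sides whatever
    the sign of a - 1. *)
Lemma powR_bilipschitz a m M : 0 < a -> 0 < m -> m <= M ->
  exists c k, [/\ 0 < c, c <= k &
    forall x y, m <= x -> x <= y -> y <= M ->
      c * (y - x) <= y `^ a - x `^ a <= k * (y - x)].
Proof.
move=> a0 m0 mM; have M0 := lt_le_trans m0 mM.
have mMa : m `^ a <= M `^ a by rewrite ge0_ler_powR// ?nnegrE; exact: ltW.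
have pM : 0 < M `^ a by rewrite powR_gt0.
exists (a * (m `^ a / M)), (a * (M `^ a / m)); split.
- by rewrite !mulr_gt0 ?invr_gt0// powR_gt0.
- rewrite ler_pM2l//; apply: ler_pM => //; rewrite ?powR_ge0 ?invr_ge0 ?(ltW M0)//.
  by rewrite lef_pV2.
move=> x y mx; rewrite le_eqVlt => /predU1P[->|xy] yM.
  by rewrite !subrr !mulr0 lexx.
have x0 : 0 < x by exact: lt_le_trans mx.
have D (t : R) : 0 < t -> is_derive t 1 (powR (R:=R) ^~ a) (a * t `^ (a - 1)).
  exact: is_derive1_powR.
have dp t : t \in `]x, y[ -> is_derive t 1 (powR (R:=R) ^~ a) (a * t `^ (a - 1)).
  by rewrite in_itv/= => /andP[xt _]; apply: D; exact: lt_trans xt.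
have cp : {within `[x, y], continuous (powR (R:=R) ^~ a)}.
  apply: derivable_within_continuous => t.
  rewrite in_itv/= => /andP[xt _]; have := D t (lt_le_trans x0 xt).
  by case.
have [t] := MVT xy dp cp.
rewrite in_itv/= => /andP[xt ty] ->.
have t0 : 0 < t := lt_trans x0 xt.
rewrite !ler_pM2r ?subr_gt0// !ler_pM2l//.
have -> : t `^ (a - 1) = t `^ a / t.
  by rewrite -(mulr_powRB1 (ltW t0) a0) mulrC mulKf// gt_eqF.
have mt : m <= t by rewrite (le_trans mx)// ltW.
have tM : t <= M by rewrite (le_trans _ yM)// ltW.
apply/andP; split; apply: ler_pM;
  rewrite ?powR_ge0 ?invr_ge0 ?(ltW M0) ?(ltW t0) ?lef_pV2//;
  by rewrite ge0_ler_powR// ?nnegrE// ltW.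
Qed.

(** The means of x < y and of y < z differ by at most z - x, while the weight
    of [y, z] in the mean of x and z is at most k (z - y) / (c (z - x)): the
    factor z - x cancels.  When b lies between a and a' both means already lie
    between a and a'. *)
Lemma weighted_mean_lipschitz (q : R -> R) (mu : R -> R -> R) m M c k :
  0 < c -> c <= k ->
  (forall x y, m <= x -> x <= y -> y <= M ->
    c * (y - x) <= q y - q x <= k * (y - x)) ->
  (forall x y, mu x y = mu y x) ->
  (forall x y, m <= x -> x <= y -> y <= M -> x <= mu x y <= y) ->
  (forall x y z, m <= x -> x < y -> y < z -> z <= M ->
    mu x z * (q z - q x) = mu x y * (q y - q x) + mu y z * (q z - q y)) ->
  forall a a' b, m <= a <= M -> m <= a' <= M -> m <= b <= M ->
    `|mu a b - mu a' b| <= k / c * `|a - a'|.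
Proof.
move=> c0 ck qP mu_sym mu_itv mu_merge.
have k0 := lt_le_trans c0 ck.
have C1 : 1 <= k / c by rewrite ler_pdivlMr// mul1r.
(* p and r are the weights of the two halves of [x, z], w bounds the distance
   between their means, and u is the displacement of the overall mean. *)
have displacement (w p r x z s u : R) : x < z -> w <= z - x ->
    0 < p -> 0 < r -> c * (z - x) <= p + r -> r <= k * s ->
    0 <= w -> u * (p + r) = w * r -> `|u| <= k / c * s.
  move=> xz wzx p0 r0 pr rs w0 ue.
  have zx : 0 < z - x by rewrite subr_gt0.
  have u0 : 0 <= u.
    by rewrite -(pmulr_lge0 _ (addr_gt0 p0 r0)) ue mulr_ge0// ltW.
  rewrite ger0_norm// mulrAC ler_pdivlMr// -(ler_pM2r zx) -mulrA.
  rewrite (le_trans (ler_wpM2l u0 pr))// ue [_ * (z - x)]mulrC.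
  by rewrite ler_pM// ltW.
have key x y z : m <= x -> x < y -> y < z -> z <= M ->
    `|mu x z - mu x y| <= k / c * (z - y) /\
    `|mu x z - mu y z| <= k / c * (y - x).
  move=> mx xy yz zM; have xz := lt_trans xy yz.
  have my : m <= y by rewrite (le_trans mx)// ltW.
  have yM : y <= M by rewrite (le_trans _ zM)// ltW.
  have /andP[a1 a2] := mu_itv x y mx (ltW xy) yM.
  have /andP[b1 b2] := mu_itv y z my (ltW yz) zM.
  have e := mu_merge x y z mx xy yz zM.
  have /andP[p1 p2] := qP x y mx (ltW xy) yM.
  have /andP[r1 r2] := qP y z my (ltW yz) zM.
  have /andP[t1 _] := qP x z mx (ltW xz) zM.
  have p0 : 0 < q y - q x by rewrite (lt_le_trans _ p1)// mulr_gt0// subr_gt0.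
  have r0 : 0 < q z - q y by rewrite (lt_le_trans _ r1)// mulr_gt0// subr_gt0.
  have w0 : mu x y <= mu y z by exact: le_trans b1.
  have pr : q y - q x + (q z - q y) = q z - q x by ring.
  split; last rewrite distrC.
  - apply: (@displacement (mu y z - mu x y) (q y - q x) (q z - q y) x z) => //.
    + by rewrite lerB.
    + by rewrite pr.
    + by rewrite subr_ge0.
    + by rewrite pr mulrBl e; ring.
  - apply: (@displacement (mu y z - mu x y) (q z - q y) (q y - q x) x z) => //.
    + by rewrite lerB.
    + by rewrite [q z - q y + _]addrC pr.
    + by rewrite subr_ge0.
    + by rewrite [q z - q y + _]addrC pr mulrBl e; ring.
move=> a a' b /andP[ma aM] /andP[ma' a'M] /andP[mb bM].
wlog aa' : a a' ma aM ma' a'M / a <= a'.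
  move=> h; have [/h->//|/ltW/h] := leP a a'.
  by rewrite [ `|mu a' _ - _|]distrC [ `|a' - _|]distrC => ->.
have [->|neq] := eqVneq a a'; first by rewrite !subrr normr0 mulr0.
have lt_aa' : a < a' by rewrite lt_neqAle neq.
rewrite [ `|a - a'|]distrC [ `|a' - a|]ger0_norm ?subr_ge0//.
have [ba|ab] := ltP b a.
  have [+ _] := key b a a' mb ba lt_aa' a'M.
  by rewrite distrC [mu a b]mu_sym [mu a' b]mu_sym.
have [a'b|ba'] := ltP a' b; first by have [_ +] := key a a' b ma lt_aa' a'b bM.
have /andP[h1 h2] := mu_itv a b ma ab bM.
have /andP[h3 h4] := mu_itv b a' mb ba' a'M.
rewrite [mu a' b]mu_sym (@le_trans _ _ (a' - a))//.
  by rewrite ler_norml; apply/andP; split; lra.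
by rewrite -{1}[a' - a]mul1r ler_wpM2r// subr_ge0.
Qed.

Variable gamma : R.
Hypothesis gamma1 : 1 < gamma.

Lemma interface_value_sym a b :
  interface_value gamma a b = interface_value gamma b a.
Proof.
rewrite /interface_value eq_sym; case: eqVneq => [->//|_].
have sub_swap u v w t : (u - v) / (w - t) = (v - u) / (t - w) :> R.
  by rewrite -opprB -[w - t]opprB invrN mulrNN.
exact: sub_swap.
Qed.

Lemma interface_value_itv a b : 0 < a -> a <= b ->
  a <= interface_value gamma a b <= b.
Proof.
move=> a0 ab; have [+ _] := interface_valueP gamma1 a0 (lt_le_trans a0 ab).
by rewrite min_l// max_r.
Qed.

(** Both sides equal the pressure difference between x and z. *)
Lemma interface_value_merge x y z : 0 < x -> 0 < y -> 0 < z ->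
  interface_value gamma x z * (dhgamma gamma z - dhgamma gamma x) =
  interface_value gamma x y * (dhgamma gamma y - dhgamma gamma x) +
  interface_value gamma y z * (dhgamma gamma z - dhgamma gamma y).
Proof.
move=> x0 y0 z0.
have [_ h1] := interface_valueP gamma1 y0 x0.
have [_ h2] := interface_valueP gamma1 z0 y0.
have [_ h3] := interface_valueP gamma1 z0 x0.
rewrite interface_value_sym in h1; rewrite interface_value_sym in h2.
rewrite interface_value_sym in h3.
have telescope (px py pz qx qy qz u v w : R) :
    py - px = u * (qy - qx) -> pz - py = v * (qz - qy) ->
    pz - px = w * (qz - qx) ->
    w * (qz - qx) = u * (qy - qx) + v * (qz - qy).
  by move=> <- <- <-; ring.
exact: telescope h1 h2 h3.
Qed.

Lemma interface_value_lipschitzl m M : 0 < m -> m <= M ->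
  exists2 k, 0 <= k & forall a a' b, m <= a <= M -> m <= a' <= M ->
    m <= b <= M ->
    `|interface_value gamma a b - interface_value gamma a' b| <= k * `|a - a'|.
Proof.
move=> m0 mM.
have g1 : 0 < gamma - 1 by rewrite subr_gt0.
have g0 : 0 < gamma by exact: lt_trans gamma1.
have [c [k [c0 ck H]]] := powR_bilipschitz g1 m0 mM.
have s0 : 0 < gamma / (gamma - 1) by rewrite divr_gt0.
exists (gamma / (gamma - 1) * k / (gamma / (gamma - 1) * c)).
  by rewrite divr_ge0// mulr_ge0 ?(ltW s0)// ?(ltW c0)// (le_trans _ ck)// ltW.
have pos x : m <= x -> 0 < x by exact: lt_le_trans.
apply: (@weighted_mean_lipschitz (dhgamma gamma)).
- exact: mulr_gt0.
- by rewrite ler_pM2l.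
- move=> x y mx xy yM; have x0 := pos x mx.
  rewrite !dhgammaE//; last exact: lt_le_trans xy.
  by rewrite -mulrBr -!mulrA !(ler_pM2l g0) !ler_pM2l ?invr_gt0// H.
- exact: interface_value_sym.
- by move=> x y mx xy _; apply: interface_value_itv => //; exact: pos.
- move=> x y z mx xy yz _; have x0 := pos x mx; have y0 := lt_trans x0 xy.
  by apply: interface_value_merge => //; exact: lt_trans yz.
Qed.

Lemma interface_value_lipschitz m M : 0 < m -> m <= M ->
  exists2 k, 0 <= k & forall a a' b b', m <= a <= M -> m <= a' <= M ->
    m <= b <= M -> m <= b' <= M ->
    `|interface_value gamma a b - interface_value gamma a' b'| <=
      k * (`|a - a'| + `|b - b'|).
Proof.
move=> m0 mM; have [k k0 H] := interface_value_lipschitzl m0 mM.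
exists k => // a a' b b' ha ha' hb hb'.
rewrite (le_trans (ler_distD (interface_value gamma a' b) _ _))// mulrDr lerD ?H//.
by rewrite interface_value_sym [interface_value gamma a' b']interface_value_sym H.
Qed.

End InterfaceValue.

(** * Parametrised implicit equations in row vectors *)

(** Joins the complete and the normed structures of row vectors, as required by
    Banach's fixed point theorem. *)
HB.instance Definition _ (R : realType) n := Complete.on 'rV[R]_n.

Section RowNorm.
Context {R : realType} {n : nat}.
Implicit Types (x : 'rV[R]_n).

Lemma normr_coord_le x j : `|x 0 j| <= `|x|.
Proof.
rewrite /Num.norm /= mx_normrE.
exact: (le_bigmax _ (fun ij => `|x ij.1 ij.2|) (0, j)).
Qed.

Lemma normr_row_le x c : 0 <= c -> (forall j, `|x 0 j| <= c) -> `|x| <= c.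
Proof.
move=> c0 h; rewrite /Num.norm /= mx_normrE; apply: bigmax_le => // -[i j] _ /=.
by rewrite (ord1 i).
Qed.

End RowNorm.

Section BoundedLipschitz.
Context {R : realType} {V : normedModType R} {P : Type}.
Variables (A : set P) (D : set V).
Implicit Types (f g : P -> V -> R).

Definition bounded_lipschitz_by (c : R) f := forall p, A p ->
  forall x, D x -> `|f p x| <= c /\
    forall y, D y -> `|f p x - f p y| <= c * `|x - y|.

(** The constant must not depend on the parameter p: it determines the
    admissible time step.  Boundedness is part of the notion so that it is
    stable under products. *)
Definition bounded_lipschitz f := exists2 c, 0 <= c & bounded_lipschitz_by c f.

Lemma bounded_lipschitz_by_le c c' f : c <= c' ->
  bounded_lipschitz_by c f -> bounded_lipschitz_by c' f.
Proof.
move=> cc' h p Ap x Dx; have [h1 h2] := h p Ap x Dx; split.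
  exact: le_trans cc'.
by move=> y Dy; rewrite (le_trans (h2 y Dy))// ler_wpM2r.
Qed.

Lemma bounded_lipschitz_param (f : P -> R) (c : R) :
  (forall p, A p -> `|f p| <= c) -> bounded_lipschitz (fun p _ => f p).
Proof.
move=> fc; exists `|c| => // p Ap x _; split.
  by rewrite (le_trans (fc p Ap))// ler_norm.
by move=> y _; rewrite subrr normr0 mulr_ge0.
Qed.

Lemma bounded_lipschitz_cst (c : R) : bounded_lipschitz (fun _ _ => c).
Proof. exact: (@bounded_lipschitz_param (fun=> c) `|c|). Qed.

Lemma bounded_lipschitzD f g : bounded_lipschitz f -> bounded_lipschitz g ->
  bounded_lipschitz (fun p x => f p x + g p x).
Proof.
move=> [c c0 hf] [c' c'0 hg]; exists (c + c'); first exact: addr_ge0.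
move=> p Ap x Dx; have [f1 f2] := hf p Ap x Dx; have [g1 g2] := hg p Ap x Dx.
split; first by rewrite (le_trans (ler_normD _ _))// lerD.
move=> y Dy; rewrite opprD addrACA (le_trans (ler_normD _ _))//.
by rewrite mulrDl lerD ?f2 ?g2.
Qed.

Lemma bounded_lipschitzM f g : bounded_lipschitz f -> bounded_lipschitz g ->
  bounded_lipschitz (fun p x => f p x * g p x).
Proof.
move=> [c c0 hf] [c' c'0 hg]; exists (c * c' + c * c').
  by rewrite addr_ge0// mulr_ge0.
move=> p Ap x Dx; have [f1 f2] := hf p Ap x Dx; have [g1 g2] := hg p Ap x Dx.
split; first by rewrite normrM (le_trans (ler_pM _ _ f1 g1))// lerDl mulr_ge0.
move=> y Dy; have -> : f p x * g p x - f p y * g p y =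
  f p x * (g p x - g p y) + (f p x - f p y) * g p y by ring.
have [g3 _] := hg p Ap y Dy.
rewrite (le_trans (ler_normD _ _))// !normrM mulrDl lerD// -mulrA.
  by rewrite ler_pM// g2.
by rewrite [c' * _]mulrC mulrA ler_pM// f2.
Qed.

Lemma bounded_lipschitzN f : bounded_lipschitz f ->
  bounded_lipschitz (fun p x => - f p x).
Proof.
move=> [c c0 hf]; exists c => // p Ap x Dx; have [f1 f2] := hf p Ap x Dx.
split; first by rewrite normrN.
by move=> y Dy; rewrite -opprD normrN f2.
Qed.

Lemma bounded_lipschitzB f g : bounded_lipschitz f -> bounded_lipschitz g ->
  bounded_lipschitz (fun p x => f p x - g p x).
Proof. by move=> hf hg; apply: bounded_lipschitzD (bounded_lipschitzN hg). Qed.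

Lemma bounded_lipschitz_sum (I : finType) (F : I -> P -> V -> R) :
  (forall i, bounded_lipschitz (F i)) ->
  bounded_lipschitz (fun p x => \sum_i F i p x).
Proof.
move=> hF; elim: (index_enum I) => [|i s IHs].
  under eq_fun do under eq_fun do rewrite big_nil.
  exact: bounded_lipschitz_cst.
under eq_fun do under eq_fun do rewrite big_cons.
exact: bounded_lipschitzD.
Qed.

Lemma bounded_lipschitz_comp2 f g (h : R -> R -> R) (m M k : R) :
  m <= M -> 0 <= k ->
  (forall a a' b b', m <= a <= M -> m <= a' <= M ->
    m <= b <= M -> m <= b' <= M ->
    `|h a b - h a' b'| <= k * (`|a - a'| + `|b - b'|)) ->
  (forall p x, A p -> D x -> m <= f p x <= M) ->
  (forall p x, A p -> D x -> m <= g p x <= M) ->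
  bounded_lipschitz f -> bounded_lipschitz g ->
  bounded_lipschitz (fun p x => h (f p x) (g p x)).
Proof.
move=> mM k0 hL fD gD [c c0 hf] [c' c'0 hg].
have mmM : m <= m <= M by rewrite lexx.
set B := `|h m m| + k * ((M - m) + (M - m)).
have B0 : 0 <= B by rewrite addr_ge0// mulr_ge0// addr_ge0// subr_ge0.
have K0 : 0 <= k * (c + c') by rewrite mulr_ge0// addr_ge0.
exists (B + k * (c + c')); first exact: addr_ge0.
have near t : m <= t <= M -> `|t - m| <= M - m.
  by move=> /andP[mt tM]; rewrite ger0_norm ?subr_ge0// lerD2r.
move=> p Ap x Dx; have [f1 f2] := hf p Ap x Dx; have [g1 g2] := hg p Ap x Dx.
have fx := fD p x Ap Dx; have gx := gD p x Ap Dx; split.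
  rewrite (@le_trans _ _ B)// ?lerDl//.
  rewrite -[h (f p x) (g p x)](subrK (h m m)) addrC.
  rewrite (le_trans (ler_normD _ _))// lerD2l.
  by rewrite (le_trans (hL _ _ _ _ fx mmM gx mmM))// ler_wpM2l// lerD// near.
move=> y Dy; rewrite (le_trans (hL _ _ _ _ fx (fD p y Ap Dy) gx (gD p y Ap Dy)))//.
rewrite (@le_trans _ _ (k * (c + c') * `|x - y|))//.
  by rewrite -mulrA ler_wpM2l// mulrDl lerD ?f2 ?g2.
by rewrite ler_wpM2r// lerDr.
Qed.

End BoundedLipschitz.

Lemma bounded_lipschitz_coord {R : realType} {n : nat} {P : Type} (A : set P)
    (D : set 'rV[R]_n) (M : R) (j : 'I_n) : 0 <= M ->
  (forall x, D x -> `|x 0 j| <= M) ->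
  bounded_lipschitz A D (fun _ x => x 0 j).
Proof.
move=> M0 DM; exists (M + 1); first by rewrite addr_ge0.
move=> p Ap x Dx; split.
  by rewrite (le_trans (DM x Dx))// lerDl.
move=> y Dy; have := normr_coord_le (x - y) j; rewrite !mxE => /le_trans; apply.
by rewrite ler_peMl// lerDr.
Qed.

(** If k bounds G and its Lipschitz constant, then for dt * k <= r the map
    x |-> x0 - dt G(x) preserves the ball of radius r, and for dt * k <= 1/2 it
    is a contraction. *)
Lemma implicit_euler_solvable {R : realType} {n : nat} {P : Type} (A : set P)
    (x0 : 'rV[R]_n) (r : R) (G : P -> 'rV[R]_n -> 'rV[R]_n) : 0 < r ->
  (forall j, bounded_lipschitz A (closed_ball x0 r) (fun p x => G p x 0 j)) ->
  exists2 dt0 : R, 0 < dt0 & forall p dt, A p -> 0 < dt <= dt0 ->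
    exists2 x, closed_ball x0 r x & x = x0 - dt *: G p x.
Proof.
move=> r0 GL; have /choice[c cP] : forall j, exists c,
    0 <= c /\ bounded_lipschitz_by A (closed_ball x0 r) c (fun p x => G p x 0 j).
  by move=> j; have [c ? ?] := GL j; exists c.
pose k := 1 + \sum_j c j.
have ck j : c j <= k.
  rewrite /k (bigD1 j)//= addrCA lerDl addr_ge0// sumr_ge0// => i _.
  by have [] := cP i.
have k0 : 0 < k.
  by rewrite ltr_wpDr// sumr_ge0// => j _; have [] := cP j.
have Gk p x : A p -> closed_ball x0 r x -> `|G p x| <= k.
  move=> Ap Dx; apply: normr_row_le => [|j]; first exact: ltW.
  by have [_ /(bounded_lipschitz_by_le (ck j))/(_ p Ap x Dx)[]] := cP j.
have GLk p x y : A p -> closed_ball x0 r x -> closed_ball x0 r y ->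
    `|G p x - G p y| <= k * `|x - y|.
  move=> Ap Dx Dy; apply: normr_row_le => [|j]; first by rewrite mulr_ge0// ltW.
  have [_ /(bounded_lipschitz_by_le (ck j))/(_ p Ap x Dx)[_ /(_ y Dy)]] := cP j.
  by rewrite !mxE.
have dt00 : 0 < Num.min (r / k) (2^-1 / k) by rewrite lt_min !divr_gt0.
exists (Num.min (r / k) (2^-1 / k)) => // p dt Ap /andP[dt_gt0].
rewrite le_min !ler_pdivlMr// => /andP[dtr dt2].
set D := closed_ball x0 r; pose F x := x0 - dt *: G p x.
have DF : {homo F : x / D x >-> D x}.
  move=> x Dx; rewrite /D closed_ballE// /closed_ball_/=.
  rewrite /F opprB addrC subrK normrZ gtr0_norm// (le_trans _ dtr)//.
  by rewrite ler_pM2l// Gk.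
have dtk0 : 0 <= dt * k by rewrite mulr_ge0// ltW.
pose HF := isFun.Build _ _ D D F DF.
pose Ff : {fun D >-> D} := HB.pack F HF.
have ctr : is_contraction Ff.
  exists (NngNum dtk0); split => /=.
    by rewrite (le_lt_trans dt2)// invf_lt1// ltr1n.
  move=> -[x y] [/= Dx Dy].
  have -> : F x - F y = - (dt *: (G p x - G p y)).
    by rewrite /F scalerBr !opprB addrC addrA subrK.
  by rewrite normrN normrZ gtr0_norm// -mulrA ler_pM2l// GLk.
have [||x Dx xE] := banach_fixed_point ctr.
- exact: closed_ball_closed.
- by exists x0; exact: closed_ballxx.
by exists x.
Qed.

(** * Faces of the grid and the momentum balance *)

Section Grid.
Context {R : realType} {d : nat}.

Lemma interior_bset (b : box R d) (x : 'rV[R]_d) :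
  (forall j, lo b j < x 0 j < hi b j) -> (bset b)° x.
Proof.
move=> bx; suff : \near x, forall j, lo b j <= (x : 'rV[R]_d) 0 j <= hi b j by [].
have := @filter_forall _ _
  (fun j (y : 'rV[R]_d) => lo b j <= y 0 j <= hi b j) (nbhs x) _.
apply=> j; have /andP[lx xh] := bx j.
have cx := @coord_continuous _ _ _ 0 j x.
near=> y; apply/andP; split; apply: ltW.
- by near: y; exact: (cvgr_gt _ cx).
- by near: y; exact: (cvgr_lt _ cx).
Unshelve. all: by end_near. Qed.

Context {Omega : set 'rV[R]_d} (T : mac_grid Omega).

(** The direction of a face is the one in which it is degenerate.  Two cells
    with the same upper face in direction i share all their bounds except
    perhaps the lower one in that direction, so a point just below the face is
    interior to both; they coincide since distinct cells have disjoint
    interiors. *)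
Lemma upper_face_inj (K K' : cells T) (i i' : 'I_d) :
  face K i true = face K' i' true -> K = K' /\ i = i'.
Proof.
move=> /(congr1 val) /= [lE hE].
have nd (L : cells T) j : lo (val L) j < hi (val L) j.
  by apply: (@cells_nondegenerate _ _ _ T); exact: valP.
have lE' j : (if j == i then hi (val K) j else lo (val K) j) =
             (if j == i' then hi (val K') j else lo (val K') j).
  by move/matrixP: lE => /(_ 0 j); rewrite !mxE.
have hE' j : hi (val K) j = hi (val K') j by rewrite /hi hE.
have ii' : i = i'.
  apply/eqP/negPn/negP => nii'; have := lE' i; rewrite eqxx (negPf nii') hE'.
  by move=> e; have := nd K' i; rewrite e ltxx.
split => //; subst i'; apply/eqP/negPn/negP => nKK'.
(* The centre of the intersection of the two cells. *)
pose x : 'rV[R]_d :=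
  \row_j ((Num.max (lo (val K) j) (lo (val K') j) + hi (val K) j) / 2).
have mid (L : cells T) : (forall j, hi (val L) j = hi (val K) j) ->
    (forall j, lo (val L) j <= Num.max (lo (val K) j) (lo (val K') j)) ->
    (bset (val L))° x.
  move=> hL lL; apply: interior_bset => j; rewrite !mxE.
  have : Num.max (lo (val K) j) (lo (val K') j) < hi (val K) j.
    by rewrite gt_max nd hE' nd.
  by have := lL j; rewrite hL => h1 h2; apply/andP; split; lra.
have nvKK' : val K != val K' by apply: contra_neq nKK'; exact: val_inj.
have := @cells_disjoint _ _ _ T (val K) (val K') (valP K) (valP K') nvKK'.
apply/eqP/set0P; exists x; split; apply: mid => // j.
- by rewrite le_max lexx.
- by rewrite le_max lexx orbT.
Qed.

Lemma dual_mean_gt0 (q : cells T -> R) (K L : cells T) i s :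
  (forall K, 0 < q K) -> 0 < dual_mean q K L i s.
Proof.
move=> q0.
have vhalf (N : cells T) t : 0 < vol (Defs.half (val N) i t).
  rewrite /vol prodr_gt0// => j _.
  have : lo (val N) j < hi (val N) j.
    by apply: (@cells_nondegenerate _ _ _ T); exact: valP.
  rewrite subr_gt0 /Defs.half /lo /hi.
  case: t => /=; rewrite mxE; case: eqP => // -> h;
    rewrite ?ltr_pdivrMr// ?ltr_pdivlMr//; lra.
by rewrite /dual_mean /dual_vol divr_gt0// addr_gt0// mulr_gt0.
Qed.

(** On each internal face (S2) is linear in the new velocity, with leading
    coefficient a positive mean of rho divided by dt. *)
Lemma momentum_solvable gamma eps C phi eta dt (rhon rho : cells T -> R)
    (un : faces T -> R) : dt != 0 -> (forall K, 0 < rho K) ->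
  exists u, H_E0 u /\ S2 gamma eps C phi eta dt rhon un rho u.
Proof.
move=> dt0 rho0.
pose rhs i K L := (dual_mean rhon K L i true * un (face K i true)
    + dt * (- ((eps ^+ 2)^-1 *
         (rho_face gamma rho K L * grad (phi_cell gamma C phi) K L i true))
     - (eps ^+ 2)^-1 * grad (pressure gamma rho) K L i true
     - (\sum_(j < d) \sum_(s : bool)
         dual_flux gamma eps C phi eta dt rho un K L i j s
           * upwind gamma eps C phi eta dt rho un K L i j s)
        / dual_vol K L i true)) / dual_mean rho K L i true.
(* By [upper_face_inj] there is only one pair to pick on each face. *)
pose u (sigma : faces T) : R :=
  if [pick p : cells T * 'I_d | (face p.1 p.2 true == sigma)
        && isSome (neighbor p.1 p.2 true)] is Some p
  then if neighbor p.1 p.2 true is Some L then rhs p.2 p.1 L else 0 else 0.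
exists u; split.
  move=> sigma ext; rewrite /u; case: pickP => // -[K i] /= /andP[/eqP e].
  by rewrite /neighbor e ext.
move=> i K L KL.
have -> : u (face K i true) = rhs i K L.
  rewrite /u; case: pickP => [[K' i'] /= /andP[/eqP/upper_face_inj[-> ->]]|].
    by rewrite KL.
  by move=> /(_ (K, i)); rewrite /= eqxx KL.
rewrite /rhs; have := dual_mean_gt0 K L i true rho0.
set a := dual_mean rho _ _ _ _; set b := dual_mean rhon _ _ _ _ * _.
set S := _ / dual_vol _ _ _ _; set P := _ * grad (pressure _ _) _ _ _ _.
move: a b S P => a b S P a0.
have cancel_mean X : a * (X / a) = X by rewrite mulrC divfK// gt_eqF.
have cancel_step X : (b + dt * X - b) / dt = X by rewrite addrC addKr mulrC mulKf.
have cancel_rest X : X - P - S + S + P = X by ring.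
by rewrite cancel_mean cancel_step cancel_rest.
Qed.

End Grid.

(** * The mass balance *)

Section MassBalance.
Context {R : realType} {d : nat} {Omega : set 'rV[R]_d} (T : mac_grid Omega).
Variables (gamma eps C : R) (phi : 'rV[R]_d -> R) (eta : faces T -> R).
Hypothesis gamma1 : 1 < gamma.

Lemma normr_le_max_velocity (u : faces T -> R) sigma : `|u sigma| <= max_velocity u.
Proof. exact: (le_bigmax _ (fun sigma => `|u sigma|) sigma). Qed.

(** Densities as row vectors, so as to work in a complete normed space. *)
Definition density (x : 'rV[R]_#|{: cells T}|) (K : cells T) : R :=
  x 0 (enum_rank K).

(** Pairs of a velocity and a time step.  The time step is bounded because it
    is a factor of the velocity correction in the flux. *)
Definition small_data (U : R) : set ((faces T -> R) * R) :=
  [set p | max_velocity p.1 <= U /\ 0 < p.2 <= 1].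

Section FluxRegularity.
Variables (U m M : R) (D : set 'rV[R]_#|{: cells T}|).
Hypothesis m0 : 0 < m.
Hypothesis mM : m <= M.
Hypothesis Dm : forall x j, D x -> m <= x 0 j <= M.
Let A := small_data U.

Lemma bounded_lipschitz_density K : bounded_lipschitz A D (fun _ x => density x K).
Proof.
have M0 : 0 < M by exact: lt_le_trans mM.
apply: (@bounded_lipschitz_coord _ _ _ _ _ M) => [|x Dx]; first exact: ltW.
have /andP[mx xM] := Dm (enum_rank K) Dx.
by rewrite ger0_norm// (le_trans _ mx)// ltW.
Qed.

Lemma bounded_lipschitz_rho_face K L :
  bounded_lipschitz A D (fun _ x => rho_face gamma (density x) K L).
Proof.
have [k k0 H] := interface_value_lipschitz gamma1 m0 mM.
apply: (bounded_lipschitz_comp2 mM k0 H) => [p x _ Dx|p x _ Dx||];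
  by [exact: Dm | exact: bounded_lipschitz_density].
Qed.

Lemma bounded_lipschitz_pressure K :
  bounded_lipschitz A D (fun _ x => pressure gamma (density x) K).
Proof.
have gamma0 : 0 < gamma by exact: lt_trans gamma1.
have [c [k [c0 ck H]]] := powR_bilipschitz gamma0 m0 mM.
have k0 : 0 <= k by rewrite (le_trans _ ck)// ltW.
have H' a a' : m <= a <= M -> m <= a' <= M ->
    `|a `^ gamma - a' `^ gamma| <= k * `|a - a'|.
  wlog aa' : a a' / a <= a'.
    move=> h ma ma'; have [aa'|/ltW aa'] := leP a a'; first exact: h.
    by rewrite distrC [ `|a - a'|]distrC; exact: h.
  move=> /andP[ma _] /andP[_ a'M]; have /andP[h1 h2] := H _ _ ma aa' a'M.
  rewrite distrC [ `|a - a'|]distrC !ger0_norm ?subr_ge0//.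
  by rewrite -subr_ge0 (le_trans _ h1)// mulr_ge0 ?subr_ge0// ltW.
apply: (bounded_lipschitz_comp2 (f := fun _ x => density x K)
  (g := fun _ x => density x K) (h := fun a _ => a `^ gamma) mM k0).
- move=> a a' b b' ma ma' _ _; rewrite (le_trans (H' _ _ ma ma'))// ler_wpM2l//.
  by rewrite lerDl.
- by move=> p x _ Dx; exact: Dm.
- by move=> p x _ Dx; exact: Dm.
- exact: bounded_lipschitz_density.
- exact: bounded_lipschitz_density.
Qed.

Lemma bounded_lipschitz_flux K i s : bounded_lipschitz A D
  (fun p x => flux gamma eps C phi eta p.2 (density x) p.1 K i s).
Proof.
rewrite /flux; case: neighbor => [L|]; last exact: bounded_lipschitz_cst.
have cst := bounded_lipschitz_cst A D.
have rf := bounded_lipschitz_rho_face K L.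
apply: bounded_lipschitzM (cst _); apply: bounded_lipschitzM.
  exact: bounded_lipschitzM (cst _) rf.
apply: bounded_lipschitzB.
  apply: (@bounded_lipschitz_param _ _ _ A D (fun p => p.1 (face K i s)) U).
  move=> p [pU _].
  exact: le_trans (normr_le_max_velocity _ _) pU.
rewrite /delta_u; apply: bounded_lipschitzM.
  apply: bounded_lipschitzM (cst _).
  apply: bounded_lipschitzM; first exact: cst.
  apply: (@bounded_lipschitz_param _ _ _ A D (fun p => p.2) 1).
  move=> p [_ /andP[p0 p1]].
  by rewrite gtr0_norm.
apply: bounded_lipschitzD; last exact: bounded_lipschitzM rf (cst _).
rewrite /grad; apply: bounded_lipschitzM (cst _).
apply: bounded_lipschitzM; first exact: cst.
by apply: bounded_lipschitzB; exact: bounded_lipschitz_pressure.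
Qed.

End FluxRegularity.

(** With m half of the smallest initial density, the closed ball of radius m
    around rhon consists of densities that are at least m. *)
Lemma mass_solvable (rhon : cells T -> R) (U : R) : (forall K, 0 < rhon K) ->
  exists2 dt0 : R, 0 < dt0 & forall un dt, max_velocity un <= U -> 0 < dt <= dt0 ->
    exists2 rho, forall K, 0 < rho K & S1 gamma eps C phi eta dt rhon un rho.
Proof.
move=> rhon0; pose n := #|{: cells T}|.
pose x0 : 'rV[R]_n := \row_j rhon (enum_val j).
pose m : R := (\big[Num.min/1]_(K : cells T) rhon K) / 2.
have m0 : 0 < m by rewrite divr_gt0//; apply: lt_bigmin.
have mrhon K : m + m <= rhon K by rewrite -splitr; exact: bigmin_le.
pose D := closed_ball x0 m.
have Dm x j : D x -> m <= x 0 j <= `|x0| + m + m.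
  rewrite /D closed_ballE// /closed_ball_/= => x0x.
  have := le_trans (normr_coord_le (x0 - x) j) x0x; rewrite !mxE.
  have := normr_coord_le x0 j; rewrite !mxE !ler_norml.
  have := mrhon (enum_val j) => h1 /andP[h2 h3] /andP[h4 h5].
  by apply/andP; split; lra.
have mM : m <= `|x0| + m + m by rewrite lerDr addr_ge0// ltW.
pose G (p : (faces T -> R) * R) (x : 'rV[R]_n) : 'rV[R]_n := \row_j
  ((\sum_(i < d) \sum_(s : bool)
     flux gamma eps C phi eta p.2 (density x) p.1 (enum_val j) i s)
     / vol (val (enum_val j : cells T))).
have [|dt0 dt00 H] :=
    @implicit_euler_solvable R n _ (small_data U) x0 m G m0.
  move=> j; under eq_fun do under eq_fun do rewrite mxE.
  apply: bounded_lipschitzM (bounded_lipschitz_cst _ _ _).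
  apply: bounded_lipschitz_sum => i; apply: bounded_lipschitz_sum => s.
  exact: bounded_lipschitz_flux m0 mM Dm _ _ _.
exists (Num.min dt0 1); first by rewrite lt_min dt00 ltr01.
move=> un dt unU /andP[dt_gt0]; rewrite le_min => /andP[dt_dt0 dt1].
have [||x Dx xE] := H (un, dt) dt.
- by split => //=; rewrite dt_gt0.
- by rewrite dt_gt0.
exists (density x) => K.
  by rewrite (lt_le_trans m0)//; have /andP[] := Dm x (enum_rank K) Dx.
have -> : density x K = rhon K - dt * ((\sum_(i < d) \sum_(s : bool)
    flux gamma eps C phi eta dt (density x) un K i s) / vol (val K)).
  by rewrite {1}/density {1}xE !mxE enum_rankK.
by rewrite addrAC subrr add0r -mulrN mulrC mulKf ?gt_eqF// addNr.
Qed.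

End MassBalance.

Theorem theorem4p5 (R : realType) (d : nat) (hd : (0 < d <= 3)%N)
    (gamma eps : R) (hgamma1 : 1 < gamma) (heps : 0 < eps <= 1)
    (Omega : set 'rV[R]_d) (hOmega : domain Omega)
    (phi : 'rV[R]_d -> R) (hphi : smooth_on_closure Omega phi)
    (m0 C : R) (hC : hydrostatic gamma Omega phi m0 C)
    (T : mac_grid Omega)
    (rhon : cells T -> R) (hrhon : forall K, 0 < rhon K)
    (eta : faces T -> R) (heta : forall sigma, 0 < eta sigma) :
  exists dt0 : R -> R, (forall U, 0 < dt0 U) /\
    forall un : faces T -> R, H_E0 un ->
    forall dt : R, 0 < dt <= dt0 (max_velocity un) ->
    exists (rho : cells T -> R) (u : faces T -> R),
      [/\ H_E0 u,
          (forall K, 0 < rho K),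
          S1 gamma eps C phi eta dt rhon un rho &
          S2 gamma eps C phi eta dt rhon un rho u].
Proof.
have /choice[dt0 dt0P] : forall U : R, exists dt0 : R, 0 < dt0 /\
    forall (un : faces T -> R) dt, max_velocity un <= U -> 0 < dt <= dt0 ->
    exists2 rho, forall K, 0 < rho K & S1 gamma eps C phi eta dt rhon un rho.
  move=> U; have [dt0 ? ?] := mass_solvable eps C phi eta hgamma1 U hrhon.
  by exists dt0.
exists dt0; split=> [U|un _ dt dt_le]; first by have [] := dt0P U.
have [_ /(_ un dt (lexx _) dt_le)[rho rho0 rhoS1]] := dt0P (max_velocity un).
have dt_neq0 : dt != 0 by case/andP: dt_le => /lt0r_neq0.
have [u [u0 uS2]] :=
  momentum_solvable gamma eps C phi eta rhon un dt_neq0 rho0.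
by exists rho, u.
Qed.
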